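(* There is no norm inducing the usual topology on $C^{\infty}(\mathbb T)$, and there is no norm inducing the usual topology on $A^{\infty}(D)$. Therefore, $C^{\infty}(\mathbb T)$ is not isomorphic to $C(\mathbb T)=C^0(\mathbb T)$ and $A^{\infty}(D)$ is not isomorphic to $A(D)=A^0(D)$.
   Context: $D$ is the open unit disc in $\mathbb C$, $\mathbb T=\partial D$. $C^{\infty}(\mathbb T)$ is the space of $f:\mathbb T\to\mathbb C$ such that $\theta\mapsto f(e^{i\theta})$ is infinitely differentiable; its usual topology is given by the semi-norms $\|d^lf/d\theta^l\|_\infty$, $l\ge 0$. $A^{\infty}(D)$ is the space of holomorphic functions on $D$ all of whose derivatives $f^{(l)}$, $l\ge 0$, extend continuously to $\overline D$; its usual topology is given by the semi-norms $\sup_{\overline D}|f^{(l)}|$, $l\ge0$. $C(\mathbb T)$ is the space of continuous complex functions on $\mathbb T$ and $A(D)$ the disc algebra (holomorphic functions on $D$ extending continuously to $\overline D$), both with the supremum norm. ''Isomorphic'' means linearly homeomorphic. *)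

(* Defs.v *)
From HB Require Import structures.
From mathcomp Require Import all_boot all_order all_algebra.
From mathcomp Require Import all_classical all_reals all_analysis.
From mathcomp Require Import complex.

Set Implicit Arguments.
Unset Strict Implicit.
Unset Printing Implicit Defensive.

Import Order.TTheory GRing.Theory Num.Theory.
Import numFieldNormedType.Exports.
Import ComplexField.Normc.

Local Open Scope classical_set_scope.
Local Open Scope ring_scope.
Local Open Scope complex_scope.

(* R[i] is the normed space C over itself; its alias Rcomplex R, the same set
   with the same topology, is C as a normed space over the reals. Complex
   derivatives are taken in the former, derivatives with respect to a real
   variable in the latter. *)
HB.instance Definition _ (R : realType) := NormedModule.copy R[i] R[i]^o.

HB.instance Definition _ (R : realType) :=
  PseudoMetric.copy (Rcomplex R) (pseudoMetric_normed (Rcomplex R)).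
HB.instance Definition _ (R : realType) := isPointed.Build (Rcomplex R) 0.
HB.instance Definition _ (R : realType) :=
  NormedZmod_PseudoMetric_eq.Build R (Rcomplex R) erefl.

Lemma Rcomplex_normrZ (R : realType) (a : R) (z : Rcomplex R) :
  `|a *: z| = `|a| * `|z|.
Proof.
case: z => x y; rewrite /Num.norm /= !exprMn -mulrDr sqrtrM ?sqr_ge0 //.
by rewrite sqrtr_sqr.
Qed.

HB.instance Definition _ (R : realType) :=
  PseudoMetricNormedZmod_Lmodule_isNormedModule.Build R (Rcomplex R)
    (@Rcomplex_normrZ R).

Section SeminormTopology.
Variables (R : realType) (E : lmodType R[i]) (I : eqType) (p : I -> E -> R).

(* E with the topology in which the sets seminorm_ball s x e, with s finite and
   e > 0, form a neighbourhood basis of x whenever the p i are seminorms. *)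
Definition seminormed of (I -> E -> R) : Type := E.

Local Notation S := (seminormed p).

HB.instance Definition _ := GRing.Lmodule.on S.

Definition seminorm_ball (s : seq I) (x : E) (e : R) : set E :=
  [set y | forall i, i \in s -> p i (y - x) < e].

Definition seminorm_open : set_system S :=
  [set U | forall x, U x ->
     exists s : seq I, exists2 e : R, 0 < e & seminorm_ball s x e `<=` U].

Lemma seminorm_openT : seminorm_open setT.
Proof. by move=> x _; exists [::]; exists 1. Qed.

Lemma seminorm_openI : setI_closed seminorm_open.
Proof.
move=> U V oU oV x [/oU[s [d d0 sU]] /oV[t [e e0 tV]]].
exists (s ++ t); exists (Order.min d e); first by rewrite lt_min d0.
move=> y yst; split.
  by apply: sU => i si; have := yst i; rewrite mem_cat si lt_min => /(_ isT)/andP[].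
by apply: tV => i si; have := yst i; rewrite mem_cat si orbT lt_min => /(_ isT)/andP[].
Qed.

Lemma seminorm_open_bigU (J : Type) (U : J -> set S) :
  (forall j, seminorm_open (U j)) -> seminorm_open (\bigcup_j U j).
Proof.
move=> oU x [j _ /oU[s [e e0 sU]]]; exists s; exists e => // y /sU Uy.
by exists j.
Qed.

HB.instance Definition _ := isOpenTopological.Build S
  seminorm_openT seminorm_openI seminorm_open_bigU.

End SeminormTopology.

Definition is_norm (R : realType) (E : lmodType R[i]) (N : E -> R) : Prop :=
  [/\ forall x, 0 <= N x,
      forall x, N x = 0 -> x = 0,
      forall (a : R[i]) x, N (a *: x) = normc a * N x
    & forall x y, N (x + y) <= N x + N y].

Definition induces_topology (R : realType) (E : preTopologicalLmodType R[i])
    (N : E -> R) : Prop :=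
  forall x : E, nbhs x = nbhs_ball_ (ball_ N) x.

Definition normable (R : realType) (E : preTopologicalLmodType R[i]) : Prop :=
  exists N : E -> R, is_norm N /\ induces_topology N.

Definition isomorphic (R : realType) (E F : preTopologicalLmodType R[i]) :
    Prop :=
  exists (f : {linear E -> F}) (g : F -> E),
    [/\ cancel f g, cancel g f, continuous f & continuous g].

Section DeriveLinear.
Variables (K : numFieldType) (V W : normedModType K).
Variables (U : set K) (openU : open U).

Definition derivable_all (f : K -> V) : Prop :=
  forall l z, U z -> derivable (derive1n l f) z 1.

Lemma derive1n_add (f g : K -> V) : derivable_all f -> derivable_all g ->
  forall l z, U z ->
    derive1n l (f + g) z = derive1n l f z + derive1n l g z.
Proof.
move=> df dg; elim=> [//|l IHl] z Uz; rewrite !derive1nS !derive1E.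
rewrite -deriveD; [|exact: df|exact: dg].
apply: near_eq_derive; apply: filterS (open_nbhs_nbhs (conj openU Uz)) => w Uw.
exact: IHl.
Qed.

Lemma derivable_allD (f g : K -> V) : derivable_all f -> derivable_all g ->
  derivable_all (f + g).
Proof.
move=> df dg l z Uz.
have : derivable (derive1n l f + derive1n l g) z 1.
  by apply: derivableD; [exact: df|exact: dg].
apply: near_eq_derivable; apply: filterS (open_nbhs_nbhs (conj openU Uz)) => w Uw.
by rewrite derive1n_add.
Qed.

Lemma derivable_comp_linear (L : {linear V -> W}) (f : K -> V) z :
  continuous L -> derivable f z 1 ->
  derivable (L \o f) z 1 /\ derive1 (L \o f) z = L (derive1 f z).
Proof.
move=> cL df.
have : (fun h : K => h^-1 *: (((L \o f) \o shift z) (h *: 1) - (L \o f) z))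
         @ 0^' --> L ('D_1 f z).
  under [X in X @ _]eq_fun => h do rewrite /= -linearB -linearZ.
  by apply: (@cvg_comp _ _ _ _ L _ _ _ df); exact: cL.
move=> cvgL; split; first by apply/cvg_ex; eexists; exact: cvgL.
by rewrite !derive1E; exact: cvg_lim cvgL.
Qed.

Lemma derive1n_comp_linear (L : {linear V -> W}) (f : K -> V) :
  continuous L -> derivable_all f ->
  forall l z, U z ->
    derive1n l (L \o f) z = L (derive1n l f z).
Proof.
move=> cL df; elim=> [//|l IHl] z Uz; rewrite !derive1nS.
have [_ <-] := derivable_comp_linear cL (df l z Uz); rewrite !derive1E.
apply: near_eq_derive; apply: filterS (open_nbhs_nbhs (conj openU Uz)) => w Uw.
exact: IHl.
Qed.

End DeriveLinear.

Lemma derivable_all_comp_linear (K : numFieldType) (V W : normedModType K)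
  (U : set K) (openU : open U) (L : {linear V -> W}) (f : K -> V) :
  continuous L -> derivable_all U f -> derivable_all U (L \o f).
Proof.
move=> cL df l z Uz.
have [+ _] := derivable_comp_linear cL (df l z Uz).
apply: near_eq_derivable; apply: filterS (open_nbhs_nbhs (conj openU Uz)) => w Uw.
by rewrite (derive1n_comp_linear openU).
Qed.

Lemma derive1n_cst0 (K : numFieldType) (V : normedModType K) l :
  derive1n l (fun=> 0 : V) = (fun=> 0) :> (K -> V).
Proof.
elim: l => [//|l IHl]; rewrite derive1nS IHl; apply/funext => z.
exact: derive1_cst.
Qed.

Lemma derivable_all0 (K : numFieldType) (V : normedModType K) (U : set K) :
  derivable_all U (fun=> 0 : V).
Proof. by move=> l z _; rewrite derive1n_cst0; exact: derivable_cst. Qed.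

Definition Rcomplex_mul (R : realType) (a z : Rcomplex R) : Rcomplex R := a * z.

Lemma Rcomplex_mul_linear (R : realType) (a : Rcomplex R) :
  linear (Rcomplex_mul a).
Proof.
rewrite /Rcomplex_mul => k [x y] [x' y']; rewrite mulrDr; congr (_ + _).
case: a => a b; apply/eqP.
by rewrite eq_complex /= !mulrBr !mulrDr !(mulrCA k) !eqxx.
Qed.

HB.instance Definition _ (R : realType) (a : Rcomplex R) :=
  GRing.isLinear.Build R (Rcomplex R) (Rcomplex R) _ (Rcomplex_mul a)
    (Rcomplex_mul_linear a).

Lemma Rcomplex_mul_continuous (R : realType) (a : Rcomplex R) :
  continuous (Rcomplex_mul a).
Proof.
apply: bounded_linear_continuous; apply/linear_boundedP; exists `|a|.
split=> [//|r ar z].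
have -> : `|Rcomplex_mul a z| = `|a| * `|z| by exact: normcM.
by apply: ler_wpM2r => //; exact: ltW.
Qed.

Section Circle.
Variable R : realType.

Definition circle : set R[i] := [set z | `|z| = 1].

Lemma expi_subproof (t : R) : (cos t +i* sin t) \in circle.
Proof.
by apply/mem_set; rewrite /circle /= normc_def /= cos2Dsin2 sqrtr1.
Qed.

Definition expi (t : R) : circle := SigSub (expi_subproof t).

Definition circle_derivative (l : nat) (f : circle -> R[i]) : R -> Rcomplex R :=
  derive1n l (fun t => f (expi t) : Rcomplex R).

Definition smooth_circle : {pred circle -> R[i]} :=
  [pred f | `[< forall l t, derivable (circle_derivative l f) t 1 >]].

Definition continuous_circle : {pred circle -> R[i]} :=
  [pred f | `[< continuous f >]].

Lemma smooth_circleP (f : circle -> R[i]) :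
  reflect (derivable_all setT (fun t => f (expi t) : Rcomplex R))
    (f \in smooth_circle).
Proof. by apply: (iffP (asboolP _)) => df l t; [move=> _|]; exact: df. Qed.

Lemma smooth_circle_submod : GRing.subsemimod_closed smooth_circle.
Proof.
split; first split.
- by apply/smooth_circleP; exact: (@derivable_all0 R (Rcomplex R)).
- move=> f g /smooth_circleP df /smooth_circleP dg; apply/smooth_circleP.
  by apply: (derivable_allD openT df dg).
- move=> a f /smooth_circleP df; apply/smooth_circleP.
  exact: (derivable_all_comp_linear openT (Rcomplex_mul_continuous (a := a)) df).
Qed.

Lemma continuous_circle_submod : GRing.subsemimod_closed continuous_circle.
Proof.
split; first split.
- by apply/asboolP => z; exact: (@cst_continuous _ _ (0 : R[i])).
- move=> f g /asboolP cf /asboolP cg; apply/asboolP => z.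
  exact: cvgD (cf z) (cg z).
- move=> a f /asboolP cf; apply/asboolP => z.
  exact: cvgZl_tmp (cf z).
Qed.

HB.instance Definition _ := GRing.isSubmodClosed.Build _ _ smooth_circle
  smooth_circle_submod.
HB.instance Definition _ := GRing.isSubmodClosed.Build _ _ continuous_circle
  continuous_circle_submod.

Definition smooth_circle_fun : Type := {f | f \in smooth_circle}.
HB.instance Definition _ := SubChoice.on smooth_circle_fun.
HB.instance Definition _ := [SubChoice_isSubLmodule of smooth_circle_fun by <:].

Definition continuous_circle_fun : Type := {f | f \in continuous_circle}.
HB.instance Definition _ := SubChoice.on continuous_circle_fun.
HB.instance Definition _ :=
  [SubChoice_isSubLmodule of continuous_circle_fun by <:].

(* The suprema are finite because the circle is compact; this matters since
   sup is 0 on unbounded sets. *)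
Definition circle_seminorm (l : nat) (f : smooth_circle_fun) : R :=
  sup (range (fun t : R => `|circle_derivative l (val f) t|)).

Definition circle_norm (_ : unit) (f : continuous_circle_fun) : R :=
  sup (range (fun z : circle => normc (val f z))).

Definition Cinfty_circle : preTopologicalLmodType R[i] :=
  seminormed circle_seminorm.

Definition C_circle : preTopologicalLmodType R[i] := seminormed circle_norm.

End Circle.

Section Disc.
Variable R : realType.

Definition disc : set R[i] := [set z | `|z| < 1].

(* The l-th complex derivative; only its values on the open set disc are
   meaningful, and there they do not depend on the extension of f by 0. *)
Definition disc_derivative (l : nat) (f : disc -> R[i]) : R[i] -> R[i] :=
  derive1n l ('valL_ 0 f).

Definition is_extension (h : R[i] -> R[i]) : set (R[i] -> R[i]) :=
  [set g | {within closure disc, continuous g} /\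
           forall z, disc z -> g z = h z].

(* sup over the closed disc of the continuous extension of h, whose values on
   the closed disc are uniquely determined by h. *)
Definition sup_closed_disc (h : R[i] -> R[i]) : R :=
  sup [set normc (xget 0 (is_extension h) z) | z in closure disc].

(* Holomorphic functions have complex derivatives of all orders; their
   existence is part of the condition, so that derive1n is never applied to a
   function that is not differentiable. *)
Definition smooth_disc : {pred disc -> R[i]} :=
  [pred f | `[< forall l,
    (forall z, disc z -> derivable (disc_derivative l f) z 1) /\
    is_extension (disc_derivative l f) !=set0 >]].

Definition disc_algebra : {pred disc -> R[i]} :=
  [pred f | `[< (forall z, disc z -> derivable ('valL_ 0 f) z 1) /\
                is_extension ('valL_ 0 f) !=set0 >]].

Lemma open_disc : open disc.
Proof.
suff -> : disc = ball (0 : R[i]) 1 by exact: ball_open.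
by apply/seteqP; split => z; rewrite -ball_normE /= sub0r normrN.
Qed.

Lemma valL0D (f g : disc -> R[i]) :
  'valL_ 0 (f + g) = 'valL_ 0 f + 'valL_ 0 g :> (R[i] -> R[i]).
Proof.
by apply/funext => z; rewrite /valL_ /= /GRing.add /=; case: ('oinv_ _ z) => //=; rewrite addr0.
Qed.

Lemma valL0Z (a : R[i]) (f : disc -> R[i]) :
  'valL_ 0 (a *: f) = a *: 'valL_ 0 f :> (R[i] -> R[i]).
Proof.
by apply/funext => z; rewrite /valL_ [RHS]/GRing.scale /=; case: ('oinv_ _ z) => //=; rewrite scaler0.
Qed.
Lemma valL00 :
  'valL_ 0 (0 : disc -> R[i]) = (fun=> 0) :> (R[i] -> R[i]).
Proof.
by apply/funext => z; rewrite /valL_ /=; case: ('oinv_ _ z).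
Qed.

Lemma is_extensionD h k g g' : is_extension h g -> is_extension k g' ->
  is_extension (h + k) (g + g').
Proof.
move=> [cg gh] [cg' gk]; split => [z|z Dz]; last by rewrite /GRing.add /= gh ?gk.
exact: cvgD (cg z) (cg' z).
Qed.
Lemma is_extensionZ a h g : is_extension h g -> is_extension (a *: h) (a *: g).
Proof.
move=> [cg gh]; split => [z|z Dz]; last by rewrite /GRing.scale /= gh.
exact: cvgZl_tmp (cg z).
Qed.
Lemma eq_is_extension h k g : (forall z, disc z -> h z = k z) ->
  is_extension h g -> is_extension k g.
Proof. by move=> hk [cg gh]; split => // z Dz; rewrite gh ?hk. Qed.

Lemma smooth_discP (f : disc -> R[i]) :
  reflect (derivable_all disc ('valL_ 0 f) /\
           forall l, is_extension (disc_derivative l f) !=set0)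
    (f \in smooth_disc).
Proof.
apply: (iffP (asboolP _)) => [df|[df ef] l].
  by split => [l z Dz|l]; have [d e] := df l; [exact: d|].
by split; [move=> z Dz; exact: df|exact: ef].
Qed.

Lemma is_extension0 : is_extension (fun=> 0) (fun=> 0).
Proof. by split => // z; exact: cvg_cst. Qed.

Lemma smooth_disc_submod : GRing.subsemimod_closed smooth_disc.
Proof.
split; first split.
- apply/smooth_discP; rewrite valL00; split; first exact: derivable_all0.
  move=> l; exists (fun=> 0); rewrite /disc_derivative valL00.
  by rewrite derive1n_cst0; exact: is_extension0.
- move=> f g /smooth_discP[df ef] /smooth_discP[dg eg]; apply/smooth_discP.
  rewrite valL0D; split; first exact: (derivable_allD open_disc df dg).
  move=> l; have [[u fu] [v gv]] := (ef l, eg l); exists (u + v).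
  apply: eq_is_extension (is_extensionD fu gv) => z Dz.
  by rewrite /disc_derivative valL0D (derive1n_add open_disc df dg).
- move=> a f /smooth_discP[df ef]; apply/smooth_discP.
  have cL := @scaler_continuous R[i] R[i] a.
  rewrite valL0Z; split; first exact: (derivable_all_comp_linear open_disc cL df).
  move=> l; have [u fu] := ef l; exists (a *: u).
  apply: eq_is_extension (is_extensionZ a fu) => z Dz.
  rewrite /disc_derivative valL0Z; symmetry.
  exact: (derive1n_comp_linear open_disc cL df).
Qed.

Lemma disc_algebra_submod : GRing.subsemimod_closed disc_algebra.
Proof.
split; first split.
- apply/asboolP; rewrite valL00; split=> [z _|]; first exact: derivable_cst.
  by exists (fun=> 0); exact: is_extension0.
- move=> f g /asboolP[df [u fu]] /asboolP[dg [v gv]]; apply/asboolP.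
  rewrite valL0D; split=> [z Dz|]; first exact: derivableD (df z Dz) (dg z Dz).
  by exists (u + v); exact: is_extensionD.
- move=> a f /asboolP[df [u fu]]; apply/asboolP.
  rewrite valL0Z; split=> [z Dz|]; first exact: derivableZ (df z Dz).
  by exists (a *: u); exact: is_extensionZ.
Qed.

HB.instance Definition _ := GRing.isSubmodClosed.Build _ _ smooth_disc
  smooth_disc_submod.
HB.instance Definition _ := GRing.isSubmodClosed.Build _ _ disc_algebra
  disc_algebra_submod.

Definition smooth_disc_fun : Type := {f | f \in smooth_disc}.
HB.instance Definition _ := SubChoice.on smooth_disc_fun.
HB.instance Definition _ := [SubChoice_isSubLmodule of smooth_disc_fun by <:].

Definition disc_algebra_fun : Type := {f | f \in disc_algebra}.
HB.instance Definition _ := SubChoice.on disc_algebra_fun.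
HB.instance Definition _ := [SubChoice_isSubLmodule of disc_algebra_fun by <:].

Definition disc_seminorm (l : nat) (f : smooth_disc_fun) : R :=
  sup_closed_disc (disc_derivative l (val f)).

Definition disc_norm (_ : unit) (f : disc_algebra_fun) : R :=
  sup_closed_disc ('valL_ 0 (val f)).

Definition Ainfty_disc : preTopologicalLmodType R[i] :=
  seminormed disc_seminorm.

Definition A_disc : preTopologicalLmodType R[i] := seminormed disc_norm.

End Disc.

Arguments circle R : clear implicits.
Arguments disc R : clear implicits.

(* Main.v *)
Require Import Defs.
From mathcomp Require Import all_boot all_order all_algebra.
From mathcomp Require Import all_classical all_reals all_analysis.
From mathcomp Require Import complex.
From mathcomp Require Import ring lra zify.

(* A normed space has a bounded neighbourhood of 0 (one absorbed by every
   neighbourhood of 0), and an isomorphism transports it. Cinfty_circle and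
   Ainfty_disc have none: a neighbourhood of 0 only controls finitely many
   seminorms, and a seminorm of higher order l is not bounded by multiples of
   the lower ones, as z ^+ n shows: its l-th seminorm is n ^+ l on the circle
   and n ^_ l on the disc. *)

Set Implicit Arguments.
Unset Strict Implicit.
Unset Printing Implicit Defensive.

Import Order.TTheory GRing.Theory Num.Theory.
Import numFieldNormedType.Exports.
Import ComplexField.Normc.

Local Open Scope classical_set_scope.
Local Open Scope ring_scope.
Local Open Scope complex_scope.

(** * Seminorms obtained as suprema *)

Definition is_seminorm (R : realType) (E : lmodType R[i]) (p : E -> R) : Prop :=
  (forall a x, p (a *: x) = normc a * p x) /\
  (forall x y, p (x + y) <= p x + p y).

Lemma normc_real (R : realType) (a : R) : normc a%:C = `|a|.
Proof. by rewrite /= expr0n addr0 sqrtr_sqr. Qed.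

Lemma normc_ge0 (R : realType) (z : R[i]) : 0 <= normc z.
Proof. by case: z => x y; exact: sqrtr_ge0. Qed.

(** Common source of the seminorm property for all the suprema on the circle and the disc.
    Boundedness matters because [sup] is 0 on unbounded sets. *)
Lemma sup_seminorm (R : realType) (E : lmodType R[i]) (T : Type) (D : set T)
    (q : T -> E -> R) : D !=set0 ->
  (forall t, D t -> is_seminorm (q t)) ->
  (forall x, has_ubound [set q t x | t in D]) ->
  is_seminorm (fun x => sup [set q t x | t in D]).
Proof.
move=> [t0 Dt0] qN qb.
have q0 x : [set q t x | t in D] !=set0 by exists (q t0 x); exists t0.
have le_q t x : D t -> q t x <= sup [set q t x | t in D].
  by move=> Dt; apply: ub_le_sup => //; exists t.
have le_sup x c : (forall t, D t -> q t x <= c) ->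
    sup [set q t x | t in D] <= c.
  by move=> qc; apply: sup_le_ub => // _ [t Dt <-]; exact: qc.
have supZ a x : sup [set q t (a *: x) | t in D] <=
    normc a * sup [set q t x | t in D].
  apply: le_sup => t Dt; rewrite (qN t Dt).1.
  by apply: ler_wpM2l; [exact: normc_ge0|exact: le_q].
split=> [a x|x y]; last first.
  apply: le_sup => t Dt; apply: le_trans ((qN t Dt).2 _ _) _.
  by apply: lerD; exact: le_q.
apply/eqP; rewrite eq_le supZ /=.
have [->|a0] := eqVneq a 0.
  rewrite normc0 mul0r; apply: le_trans (le_q t0 _ Dt0).
  by rewrite (qN t0 Dt0).1 normc0 mul0r.
have na0 : 0 < normc a.
  by rewrite lt_def normc_ge0 andbT; apply: contra_neq a0; exact: eq0_normc.
(* The inequality [supZ], applied to [a^-1] and [a *: x], gives its own converse. *)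
have := supZ a^-1 (a *: x); rewrite scalerA mulVf // scale1r.
by rewrite -(ler_pM2l na0) mulrA -normcM mulfV // normc1 mul1r.
Qed.

(** * Bounded neighbourhoods of 0 *)

Section BoundedNeighbourhood.
Variables (R : realType) (E : lmodType R[i]) (I : eqType) (p : I -> E -> R).

Lemma seminorm_ball_nbhs0 (i : I) (e : R) : is_seminorm (p i) -> 0 < e ->
  nbhs (0 : seminormed p) [set y | p i y < e].
Proof.
move=> [pZ pD] e0; rewrite nbhsE; exists [set y | p i y < e] => //.
split; last by rewrite /= -(scale0r 0) pZ normc0 mul0r.
move=> x /= xe; exists [:: i]; exists (e - p i x); first by rewrite subr_gt0.
move=> y /(_ i (mem_head _ _)); rewrite ltrBrDr /=.
by apply: le_lt_trans; have := pD (y - x) x; rewrite subrK.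
Qed.

Lemma nbhs0_seminorm_ball (U : set E) : nbhs (0 : seminormed p) U ->
  exists s : seq I, exists2 e : R, 0 < e &
    forall y, (forall i, i \in s -> p i y < e) -> U y.
Proof.
rewrite nbhsE => -[V [oV V0] VU]; have [s [e e0 sV]] := oV _ V0.
exists s; exists e => // y ye; apply: VU; apply: sV => i si.
by rewrite subr0; exact: ye.
Qed.

End BoundedNeighbourhood.

Definition absorbed (R : realType) (E : lmodType R[i]) (B U : set E) : Prop :=
  exists2 e : R, 0 < e & forall x, B x -> U (e%:C *: x).

(** Existence of a von Neumann bounded neighbourhood of 0. It depends only on the linear structure
    and the topology, so refuting it settles non-normability and non-isomorphism at once. *)
Definition locally_bounded (R : realType) (E : preTopologicalLmodType R[i]) :=
  exists2 B : set E, nbhs 0 B & forall U, nbhs 0 U -> absorbed B U.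

Lemma normable_locally_bounded (R : realType) (E : preTopologicalLmodType R[i]) :
  normable E -> locally_bounded E.
Proof.
move=> [N [[N0 _ NZ _] NE]]; rewrite /locally_bounded NE.
(* [ball_ N 0] is expressed with [N (0 - x)], so the sign has to be removed. *)
have NN x : N (- x) = N x.
  rewrite -scaleN1r NZ -(rmorph1 (real_complex R)) -rmorphN normc_real.
  by rewrite normrN1 mul1r.
exists (ball_ N 0 1); first by exists 1 => /=.
move=> U [e /= e0 eU]; exists e => // x; rewrite /ball_ /= sub0r NN => x1.
apply: eU; rewrite /= sub0r NN NZ normc_real gtr0_norm //.
by rewrite gtr_pMr.
Qed.

(** The bounded neighbourhood is the preimage under [f] of the open unit ball of [q]. Continuity of
    [g] puts the image of some [e]-ball inside [U], and scaling by [e] maps the unit ball into that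
    [e]-ball. *)
Lemma isomorphic_locally_bounded (R : realType) (E : preTopologicalLmodType R[i])
    (F : lmodType R[i]) (q : unit -> F -> R) : is_seminorm (q tt) ->
  isomorphic E (seminormed q) -> locally_bounded E.
Proof.
move=> qN [f [g [fK gK cf cg]]].
have g0 : g 0 = 0 by rewrite -(linear0 f) fK.
exists (f @^-1` [set y | q tt y < 1]).
  by apply: (cf 0); rewrite linear0; exact: seminorm_ball_nbhs0.
move=> U U0; have := cg 0 U; rewrite g0 => /(_ U0) /nbhs0_seminorm_ball.
move=> [s [e e0 sU]]; exists e => // x /= qx; rewrite -[_ *: x]fK.
apply: sU => -[] _; rewrite linearZ qN.1 normc_real gtr0_norm //.
by rewrite gtr_pMr.
Qed.

(** A bounded [B] would make [p l] bounded on [B] for every [l]. But [B] contains a set cut out by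
    finitely many [p k], and for [l] above all these [k] the seminorm [p l] is unbounded there. *)
Lemma not_locally_bounded (R : realType) (E : lmodType R[i])
    (p : nat -> E -> R) : (forall l, is_seminorm (p l)) ->
  (forall l (C : R), exists2 x, 0 < p l x &
     forall k, (k < l)%N -> C * p k x <= p l x) ->
  ~ locally_bounded (seminormed p).
Proof.
move=> pN pl [B /nbhs0_seminorm_ball[s [d d0 sB]] Babs].
pose l := (\max_(k <- s) k).+1.
have [e e0 eB] := Babs _ (seminorm_ball_nbhs0 (pN l) (ltr01 : 0 < 1 :> R)).
(* This constant yields [2 * p k x <= e * d * p l x]; the factor 2 leaves room for the strict
   inequality [p k (c x) < d]. *)
have [x x0 xl] := pl l ((e * d)^-1 * 2).
(* With this scaling [p l (e c x)] is exactly 1, just outside the open unit ball. *)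
pose c := (e * p l x)^-1.
have c0 : 0 < c by rewrite invr_gt0 mulr_gt0.
suff /eB : B (c%:C *: x).
  rewrite /= !(pN l).1 !normc_real !gtr0_norm // mulrCA /c.
  by rewrite mulVf ?ltxx // gt_eqF // mulr_gt0.
apply: sB => k ks; rewrite (pN k).1 normc_real gtr0_norm // /c.
rewrite ltr_pdivrMl ?mulr_gt0 //.
have kl : (k < l)%N by rewrite /l ltnS; apply: (leq_bigmax_seq k).
have := xl k kl; rewrite -mulrA ler_pdivrMl ?mulr_gt0 // => xk.
have : 0 < e * d * p l x by rewrite !mulr_gt0.
lra.
Qed.

(** * Finiteness of the suprema on the circle *)

Section CircleBounds.
Variable R : realType.

(** The difference quotients are already periodic, so their limits are too. *)
Lemma periodic_derive1n (V : normedModType R) (f : R -> V) (T : R) l :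
  periodic f T -> periodic (derive1n l f) T.
Proof.
elim: l => [//|l IHl] /IHl fT t; rewrite !derive1nS /derive1.
by under eq_fun => h do rewrite addrA !fT.
Qed.

Lemma periodic_bounded (g : R -> R) (T : R) : 0 < T -> periodic g T ->
  continuous g -> has_ubound (range g).
Proof.
move=> T0 gT cg.
have [t _ tM] := EVT_max (ltW T0) (continuous_subspaceT cg).
exists (g t) => _ [x _ <-].
(* Translation by [n] periods brings [x] into [[0, T]], where the maximum was taken. The sign of [n]
   is split because [periodicn] handles natural multiples. *)
pose n := Num.floor (x / T).
have -> : g x = g (x - n%:~R * T).
  case: n => n; rewrite ?NegzE ?mulrNz ?mulNr ?opprK -pmulrn mulr_natl.
    by rewrite -[in LHS](subrK (T *+ n) x) periodicn.
  by rewrite periodicn.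
apply: tM; rewrite in_itv /= subr_ge0 -ler_pdivlMr // floor_le /=.
have := floorD1_gt (x / T); rewrite ltr_pdivrMr // intrD mulrDl mul1r -/n.
lra.
Qed.

Lemma expiD2pi (t : R) : expi (t + pi *+ 2) = expi t.
Proof. by apply: val_inj; rewrite /= cosD2pi sinD2pi. Qed.

Lemma expi_surj (z : circle R) : exists t, expi t = z.
Proof.
case: z => -[x y] /[dup] /set_mem; rewrite /circle /= normc_def /= => -[].
move=> /(congr1 (fun r => r ^+ 2)); rewrite sqr_sqrtr ?addr_ge0 ?sqr_ge0 //.
rewrite expr1n => xy1 zC.
have x1 : -1 <= x <= 1.
  rewrite -ler_norml -(@expr_le1 _ 2) // real_normK ?num_real //.
  by rewrite -xy1 lerDl sqr_ge0.
have sx : sin (acos x) = `|y|.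
  by rewrite sin_acos // -sqrtr_sqr; congr Num.sqrt; lra.
have cx : cos (acos x) = x by rewrite acosK.
(* The sine of [acos x] is [|y|], so the angle is [acos x] or its opposite according to the sign of
   [y]. *)
have [y0|y0] := leP 0 y.
  by exists (acos x); apply: val_inj; rewrite /= cx sx ger0_norm.
exists (- acos x); apply: val_inj.
by rewrite /= cosN sinN cx sx ltr0_norm // opprK.
Qed.

Lemma circle_derivativeD l (f g : smooth_circle_fun R) t :
  circle_derivative l (val (f + g)) t =
  circle_derivative l (val f) t + circle_derivative l (val g) t.
Proof.
by apply: (derive1n_add openT) => //; apply/smooth_circleP; exact: valP.
Qed.

Lemma circle_derivativeZ l (a : R[i]) (f : smooth_circle_fun R) t :
  circle_derivative l (val (a *: f)) t =
  a * circle_derivative l (val f) t :> R[i].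
Proof.
apply: (derive1n_comp_linear openT (Rcomplex_mul_continuous (a := a))) => //.
by apply/smooth_circleP; exact: valP.
Qed.

Lemma continuous_norm_circle_derivative l (f : smooth_circle_fun R) :
  continuous (fun t => `|circle_derivative l (val f) t|).
Proof.
move=> t; have /smooth_circleP df := valP f.
apply: (@continuous_comp _ _ _ _ (fun z : Rcomplex R => `|z|));
  last exact: norm_continuous.
by apply/differentiable_continuous/derivable1_diffP; exact: df.
Qed.

(** Each derivative is continuous, being itself differentiable, and has period 2 pi, hence is
    bounded. *)
Lemma circle_seminorm_is_seminorm l : is_seminorm (@circle_seminorm R l).
Proof.
apply: (@sup_seminorm _ _ _ setT (fun t f => `|circle_derivative l (val f) t|)).
- by exists 0.
- move=> t _; split => [a f|f g].
    by rewrite circle_derivativeZ; exact: normcM.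
  by rewrite circle_derivativeD; exact: ler_normD.
move=> f; apply: (@periodic_bounded _ (pi *+ 2)).
- by rewrite pmulrn_rgt0 // pi_gt0.
- move=> t; rewrite /circle_derivative.
  rewrite (@periodic_derive1n _ _ (pi *+ 2)) // => u.
  by rewrite expiD2pi.
- exact: continuous_norm_circle_derivative.
Qed.

End CircleBounds.

(** * Topology of the complex plane, and the sup norm on the circle *)

Section ComplexTopology.
Variable R : realType.

Lemma normcB_sub_le (z w : R[i]) : `|normc z - normc w| <= normc (z - w).
Proof. exact: (@ler_dist_dist _ (Rcomplex R) z w). Qed.

Lemma normc_ReIm (x y : R) : normc (x +i* y) <= `|x| + `|y|.
Proof.
rewrite -(ler_pXn2r (n := 2)) ?nnegrE ?addr_ge0 ?sqrtr_ge0 //.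
rewrite sqr_sqrtr ?addr_ge0 ?sqr_ge0 // sqrrD !real_normK ?num_real //.
by have := mulr_ge0 (normr_ge0 x) (normr_ge0 y); lra.
Qed.

Lemma continuous_normc : continuous (@normc R : R[i] -> R).
Proof.
move=> z; apply/(@cvgrPdist_lt _ _ _ _ (nbhs_filter z)) => e e0.
have ec : 0 < e%:C :> R[i] by rewrite ltcR.
move: (@nbhsx_ballx _ R[i] z _ ec); apply: (@filterS _ _ (nbhs_filter z)) => w.
rewrite -ball_normE /= ltcR; exact: le_lt_trans (normcB_sub_le _ _).
Qed.

Lemma cvg_complex (T : Type) (F : set_system T) (FF : Filter F)
    (u v : T -> R) a b : u @ F --> a -> v @ F --> b ->
  (fun x => u x +i* v x : R[i]) @ F --> (a +i* b : R[i]).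
Proof.
move=> cu cv; apply/cvgrPdist_lt => -[e e']; rewrite ltcE /= => /andP[/eqP -> e0].
have e2 : 0 < e / 2 by rewrite divr_gt0.
near=> x; rewrite ltcR; apply: le_lt_trans (normc_ReIm _ _) _.
rewrite [e]splitr; apply: ltrD; near: x.
  by move/cvgrPdist_lt : cu; exact.
by move/cvgrPdist_lt : cv; exact.
Unshelve. all: by end_near. Qed.

(** The circle carries the initial topology of its inclusion, so it suffices to check the two
    coordinates. *)
Lemma continuous_expi : continuous (@expi R).
Proof.
apply/continuous_comp_initial => t.
by apply: cvg_complex; [exact: continuous_cos|exact: continuous_sin].
Qed.

Lemma discE (z : R[i]) : disc R z <-> normc z < 1.
Proof. by rewrite -ltcR. Qed.

Lemma closed_disc_subset : closure (disc R) `<=` [set z | normc z <= 1].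
Proof.
have cl : closed [set z : R[i] | normc z <= 1].
  apply: (@preimage_closed R[i] R _ [set x | x <= 1]); last exact: closed_le.
  by move=> z _; exact: continuous_normc.
rewrite [X in _ `<=` X](closure_id _).1 //; apply: closure_subset => z.
by move/discE/ltW.
Qed.

(** Heine-Borel transported from the plane: a closed subset of the continuous image of the square
    [[-1, 1] * [-1, 1]]. *)
Lemma compact_closed_disc : compact (closure (disc R)).
Proof.
pose toC (x : R * R) : R[i] := x.1 +i* x.2.
apply: (@subclosed_compact _ _ (toC @` (`[-1, 1] `*` `[-1, 1]))).
- exact: closed_closure.
- apply: continuous_compact; last first.
    by apply: compact_setX; exact: segment_compact.
  apply: continuous_subspaceT => x.
  by apply: cvg_complex; [exact: cvg_fst|exact: cvg_snd].
move=> z /closed_disc_subset /= z1; case: z z1 => x y z1; exists (x, y) => //=.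
have xy1 : x ^+ 2 + y ^+ 2 <= 1.
  rewrite -(@sqr_sqrtr _ (_ + _)) ?addr_ge0 ?sqr_ge0 //.
  by rewrite expr_le1 // sqrtr_ge0.
rewrite !in_itv /= -!ler_norml -!(@expr_le1 _ 2 `|_|) // !real_normK ?num_real //.
by split; apply: le_trans xy1; rewrite ?lerDl ?lerDr sqr_ge0.
Qed.
End ComplexTopology.

Lemma circle_norm_is_seminorm (R : realType) : is_seminorm (@circle_norm R tt).
Proof.
apply: (@sup_seminorm _ _ _ setT
  (fun z (f : continuous_circle_fun R) => normc (val f z))).
- by exists (expi 0).
- by move=> z _; split => [a f|f g]; [exact: normcM|exact: le_normcD].
move=> f; have /asboolP cf := valP f.
(* The bound is found on the real line by periodicity and carried to the circle by [expi_surj]. *)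
have [M fM] : has_ubound (range (fun t : R => normc (val f (expi t)))).
  apply: (@periodic_bounded _ _ (pi *+ 2)).
  - by rewrite pmulrn_rgt0 // pi_gt0.
  - by move=> t; rewrite expiD2pi.
  - move=> t; apply: (@continuous_comp _ _ _ (fun t => val f (expi t)));
      last exact: continuous_normc.
    by apply: continuous_comp; [exact: continuous_expi|exact: cf].
exists M => _ [z _ <-]; have [t <-] := expi_surj z.
by apply: fM; exists t.
Qed.

(** * Suprema on the closed disc *)

Section DiscBounds.
Variable R : realType.

(** Eliminates the extension chosen by [xget]: compactness of the closed disc gives the bound,
    density of the open disc the equality. Linearity can then be checked on [h] itself. *)
Lemma sup_closed_discE (h : R[i] -> R[i]) : is_extension h !=set0 ->
  has_ubound [set normc (h z) | z in disc R] /\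
  sup_closed_disc h = sup [set normc (h z) | z in disc R].
Proof.
move=> hext; rewrite /sup_closed_disc.
have [cg gh] : is_extension h (xget 0 (is_extension h)) by exact: xgetPex.
set g := xget 0 _ in cg gh *.
have cng : {within closure (disc R), continuous (fun z => normc (g z))}.
  move=> z; apply: (@continuous_comp _ R[i] R); first exact: cg.
  exact: continuous_normc.
have [M gM] : has_ubound [set normc (g z) | z in closure (disc R)].
  have /compact_bounded[M [_ MP]] := continuous_compact cng (@compact_closed_disc R).
  (* [compact_bounded] provides the bound for every number above [M], hence [M + 1]. *)
  exists (M + 1) => _ [z Dz <-]; apply: le_trans (ler_norm _) _.
  by apply: (MP (M + 1)); [rewrite ltrDl|exists z].
have D0 : disc R 0 by apply/discE; rewrite normc0.
have hub : has_ubound [set normc (h z) | z in disc R].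
  exists M => _ [z Dz <-]; rewrite -gh //; apply: gM; exists z => //.
  exact: subset_closure.
split=> //; apply/eqP; rewrite eq_le; apply/andP; split; last first.
  apply: ge_sup; first by exists (normc (h 0)), 0.
  move=> _ [z Dz <-]; apply: ub_le_sup; first by exists M.
  by exists z; [exact: subset_closure|rewrite gh].
apply: ge_sup; first by exists (normc (g 0)), 0 => //; exact: subset_closure.
move=> _ [z Dz <-]; rewrite leNgt; apply/negP => ltz.
(* If [g] were too large at [z], it would be too large on a relative neighbourhood of [z]; this
   meets the open disc, where [g] is [h]. *)
have [w [/[dup] Dw /gh ghw]] : disc R `&` [set w | closure (disc R) w ->
    sup [set normc (h z) | z in disc R] < normc (g w)] !=set0.
  apply: (Dz); have /subspace_continuousP/(_ _ Dz) := cng.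
  by move=> /cvgr_gt /(_ _ ltz).
move=> /(_ (subset_closure Dw)); rewrite ghw ltNge => /negP; apply.
by apply: ub_le_sup => //; exists w.
Qed.

Lemma disc0 : disc R !=set0.
Proof. by exists 0; apply/discE; rewrite normc0. Qed.

Lemma disc_seminorm_is_seminorm l : is_seminorm (@disc_seminorm R l).
Proof.
have sm (f : smooth_disc_fun R) := elimT (smooth_discP _) (valP f).
rewrite (_ : disc_seminorm l = fun f =>
    sup [set normc (disc_derivative l (val f) z) | z in disc R]); last first.
  by apply/funext => f; apply: (sup_closed_discE _).2; exact: (sm f).2.
apply: (@sup_seminorm _ _ _ _ (fun z f => normc (disc_derivative l (val f) z))).
- exact: disc0.
- move=> z Dz; split => [a f|f g]; rewrite /disc_derivative.
    have cL := @scaler_continuous R[i] R[i] a.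
    rewrite valL0Z (derive1n_comp_linear (@open_disc R) cL (sm f).1) //.
    exact: normcM.
  rewrite valL0D (derive1n_add (@open_disc R) (sm f).1 (sm g).1) //.
  exact: le_normcD.
- by move=> f; apply: (sup_closed_discE _).1; exact: (sm f).2.
Qed.

Lemma disc_norm_is_seminorm : is_seminorm (@disc_norm R tt).
Proof.
have ext (f : disc_algebra_fun R) : is_extension ('valL_ 0 (val f)) !=set0.
  by have /asboolP[] := valP f.
rewrite (_ : disc_norm tt = fun f =>
    sup [set normc ('valL_ 0 (val f) z) | z in disc R]); last first.
  by apply/funext => f; apply: (sup_closed_discE _).2.
apply: (@sup_seminorm _ _ _ _ (fun z f => normc ('valL_ 0 (val f) z))).
- exact: disc0.
- move=> z Dz; split => [a f|f g]; first by rewrite valL0Z; exact: normcM.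
  by rewrite valL0D; exact: le_normcD.
- by move=> f; apply: (sup_closed_discE _).1.
Qed.

End DiscBounds.

(** * The monomials and their seminorms *)

Section TestFunctions.
Variable R : realType.

Lemma cos_nat_sin_nat n (t : R) :
  (cos t +i* sin t) ^+ n = cos (n%:R * t) +i* sin (n%:R * t) :> R[i].
Proof.
elim: n => [|n IHn]; first by rewrite expr0 mul0r cos0 sin0.
rewrite exprS IHn -[n.+1%:R]/(1 *+ n.+1) mulrSr mulrDl mul1r cosD sinD.
by apply/eqP; rewrite eq_complex /=; apply/andP; split; apply/eqP; ring.
Qed.

Definition circle_pow n (z : circle R) : R[i] := val z ^+ n.

Definition expin n (t : R) : Rcomplex R := cos (n%:R * t) +i* sin (n%:R * t).

Lemma is_derive_expin n t : derivable (expin n) t 1 /\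
  derive1 (expin n) t = Rcomplex_mul (0 +i* n%:R) (expin n t).
Proof.
have line_cont (v : Rcomplex R) : continuous (fun k : R => k *: v).
  by move=> k; apply: cvgZr_tmp; exact: cvg_id.
(* The exponential is split as [cos (n t)] times the vector 1 plus [sin (n t)] times the vector i,
   so real derivatives of scalar functions suffice. *)
have line_derive (v : Rcomplex R) (f : R -> R) (df : R) : is_derive t 1 f df ->
    is_derive t (1 : R) (fun x => f x *: v) (df *: v).
  move=> [fd <-].
  have : (fun h : R =>
           h^-1 *: (((fun x => f x *: v) \o shift t) (h *: 1) - f t *: v))
         @ 0^' --> 'D_1 f t *: v.
    under [X in X @ _]eq_fun => h do rewrite /= -scalerBl scalerA.
    apply: (@cvg_comp _ _ _ _ (fun k : R => k *: v) _ _ _ fd).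
    exact: line_cont.
  move=> cl; split; first by apply/cvg_ex; eexists; exact: cl.
  exact: cvg_lim cl.
have dn : is_derive t 1 (fun x : R => n%:R * x) n%:R.
  by apply: is_derive_eq; exact: mulr1.
have dc := is_derive1_comp (is_derive_cos (n%:R * t)) dn.
have ds := is_derive1_comp (is_derive_sin (n%:R * t)) dn.
have := is_deriveD (line_derive (1 +i* 0) _ _ dc) (line_derive (0 +i* 1) _ _ ds).
rewrite (_ : _ + _ = expin n).
  move=> [df dfE]; split=> //; rewrite derive1E dfE.
  apply/eqP; rewrite /Rcomplex_mul eq_complex /=.
  by apply/andP; split; apply/eqP; rewrite /=; ring.
apply/funext => x; apply/eqP; rewrite eq_complex /=.
apply/andP; split; apply/eqP; rewrite /=; ring.
Qed.

Lemma derive1n_expin n l :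
  derive1n l (expin n) = Rcomplex_mul ((0 +i* n%:R : R[i]) ^+ l) \o expin n.
Proof.
elim: l => [|l IHl].
  by apply/funext => t; rewrite /= /Rcomplex_mul expr0 mul1r.
rewrite derive1nS IHl; apply/funext => t.
rewrite (derivable_comp_linear (@Rcomplex_mul_continuous R _) (is_derive_expin n t).1).2.
by rewrite (is_derive_expin n t).2 /Rcomplex_mul /= exprSr; exact: mulrA.
Qed.

Lemma circle_derivative_pow n l :
  circle_derivative l (circle_pow n) =
  Rcomplex_mul ((0 +i* n%:R : R[i]) ^+ l) \o expin n.
Proof.
rewrite -derive1n_expin /circle_derivative; congr (derive1n l _).
by apply/funext => t; rewrite /circle_pow /= cos_nat_sin_nat.
Qed.

Lemma circle_pow_smooth n : circle_pow n \in @smooth_circle R.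
Proof.
apply/asboolP => l t; rewrite circle_derivative_pow.
exact: (derivable_comp_linear (@Rcomplex_mul_continuous R _) (is_derive_expin n t).1).1.
Qed.

Definition smooth_circle_pow n : smooth_circle_fun R :=
  exist _ (circle_pow n) (circle_pow_smooth n).

Lemma normcX (z : R[i]) n : normc (z ^+ n) = normc z ^+ n.
Proof. by elim: n => [|n IHn]; rewrite ?normc1 // !exprS normcM IHn. Qed.

Lemma circle_seminorm_pow n l :
  circle_seminorm l (smooth_circle_pow n) = n%:R ^+ l.
Proof.
(* The modulus of the derivative is constant, so the supremum is over a singleton. *)
rewrite /circle_seminorm -[RHS]sup1; congr sup.
have E t : `|circle_derivative l (circle_pow n) t| = n%:R ^+ l.
  rewrite circle_derivative_pow; apply: etrans (normcM _ _) _.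
  rewrite normcX /= cos2Dsin2 sqrtr1 mulr1 expr0n add0r sqrtr_sqr.
  by rewrite ger0_norm.
by apply/seteqP; split => [_ [t _ <-]|_ ->] /=; [exact: E|exists 0].
Qed.

(** Allows the extension by 0 of a function on the disc to be replaced by the polynomial on the
    whole plane. *)
Lemma derive1n_eq_on (V : normedModType R[i]) (U : set R[i]) (f g : R[i] -> V) :
  open U -> (forall z, U z -> f z = g z) ->
  forall l z, U z -> derive1n l f z = derive1n l g z.
Proof.
move=> oU fg; elim=> [//|l IHl] z Uz; rewrite !derive1nS !derive1E.
apply: near_eq_derive; apply: filterS (open_nbhs_nbhs (conj oU Uz)) => w.
exact: IHl.
Qed.

(** The truncated exponent [n - l] is harmless: [n ^_ l] vanishes for [l > n]. *)
Lemma derive1n_exprn n l :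
  derive1n l (fun z : R[i] => z ^+ n) = (fun z => (n ^_ l)%:R * z ^+ (n - l)).
Proof.
elim: l => [|l IHl]; first by apply/funext => z; rewrite /= ffactn0 mul1r subn0.
rewrite derive1nS IHl; apply/funext => z; rewrite derive1E.
apply: etrans (deriveZ _ (@exprn_derivable _ (n - l) z 1)) _.
rewrite exp_derive ffactnSr subnS natrM -mulrA; congr (_ * _).
exact: mulr1.
Qed.

Definition disc_pow n (z : disc R) : R[i] := val z ^+ n.

Lemma valL_disc_pow n (z : R[i]) : disc R z -> 'valL_ 0 (disc_pow n) z = z ^+ n.
Proof.
move=> Dz; have -> : z = set_val (SigSub (mem_set Dz)) by [].
by have /(congr1 (fun f => f (SigSub (mem_set Dz)))) := valLK 0 (disc_pow n).
Qed.

Lemma disc_derivative_pow n l (z : R[i]) : disc R z ->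
  disc_derivative l (disc_pow n) z = (n ^_ l)%:R * z ^+ (n - l).
Proof.
move=> Dz; rewrite /disc_derivative.
rewrite (derive1n_eq_on (@open_disc R) (valL_disc_pow n)) //.
by rewrite derive1n_exprn.
Qed.

Lemma disc_pow_smooth n : disc_pow n \in @smooth_disc R.
Proof.
apply/asboolP => l; pose g (z : R[i]) : R[i] := (n ^_ l)%:R * z ^+ (n - l).
have dg z : derivable g z 1.
  exact: (derivableZ (@exprn_derivable _ (n - l) z 1)).
split=> [z Dz|].
  apply: near_eq_derivable (dg z).
  apply: filterS (open_nbhs_nbhs (conj (@open_disc R) Dz)) => w Dw.
  by rewrite disc_derivative_pow.
exists g; split=> [|z Dz]; last by rewrite disc_derivative_pow.
apply: continuous_subspaceT => z.
exact/differentiable_continuous/derivable1_diffP/dg.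
Qed.

Definition smooth_disc_pow n : smooth_disc_fun R :=
  exist _ (disc_pow n) (disc_pow_smooth n).

Lemma disc_seminormE l (f : smooth_disc_fun R) :
  has_ubound [set normc (disc_derivative l (val f) z) | z in disc R] /\
  disc_seminorm l f =
    sup [set normc (disc_derivative l (val f) z) | z in disc R].
Proof. by apply: sup_closed_discE; have /smooth_discP[] := valP f. Qed.

Lemma normc_nat n : normc (n%:R : R[i]) = n%:R.
Proof. by rewrite -(rmorph_nat (real_complex R)) normc_real ger0_norm. Qed.

Lemma disc_seminorm_pow_le n l :
  disc_seminorm l (smooth_disc_pow n) <= (n ^_ l)%:R.
Proof.
rewrite (disc_seminormE _ _).2; apply: ge_sup.
  by have [z Dz] := disc0 R; exists (normc (disc_derivative l (disc_pow n) z)), z.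
move=> _ [z Dz <-] /=; rewrite disc_derivative_pow // normcM normc_nat normcX.
by rewrite ler_piMr // exprn_ile1 ?normc_ge0 // ltW //; apply/discE.
Qed.

(** Bernoulli's inequality at [x = 1 / (2 (k + 1))]: the loss [k x] is at most one half. The
    successor keeps the denominator nonzero for [k = 0]. *)
Lemma bernoulli_half k : 2^-1 <= (1 - (2 * k.+1%:R)^-1) ^+ k :> R.
Proof.
have B (x : R) m : 0 <= x <= 1 -> 1 - m%:R * x <= (1 - x) ^+ m.
  move=> /andP[x0 x1]; elim: m => [|m IHm]; first by rewrite mul0r subr0.
  rewrite exprS; apply: le_trans (ler_wpM2l _ IHm); last by rewrite subr_ge0.
  by rewrite -natr1; have := mulr_ge0 (ler0n R m) (sqr_ge0 x); lra.
have k0 : 0 < 2 * k.+1%:R :> R by rewrite mulr_gt0.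
apply: le_trans (B _ _ _); last first.
  by rewrite invr_ge0 ltW //= invf_le1 // -natrM ler1n.
suff : k%:R / (2 * k.+1%:R) <= 2^-1 :> R by move: (k%:R / _) => y; lra.
by rewrite ler_pdivrMr // mulKf // ler_nat.
Qed.

(** The value [n ^_ l] is only approached at the boundary. A single real point [r] inside the disc
    costs a factor 2, which the growth comparison can afford. *)
Lemma disc_seminorm_pow_ge n l :
  (n ^_ l)%:R / 2 <= disc_seminorm l (smooth_disc_pow n).
Proof.
rewrite (disc_seminormE _ _).2.
pose r : R := 1 - (2 * (n - l).+1%:R)^-1.
have k0 : 0 < 2 * (n - l).+1%:R :> R by rewrite mulr_gt0.
have r0 : 0 <= r by rewrite subr_ge0 invf_le1 // -natrM ler1n.
have Dr : disc R r%:C.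
  apply/discE; rewrite normc_real ger0_norm // /r.
  by rewrite ltrBlDr ltrDl invr_gt0.
apply: le_trans (_ : _ <= normc (disc_derivative l (disc_pow n) r%:C)) _.
  rewrite disc_derivative_pow // normcM normc_nat normcX normc_real ger0_norm //.
  by rewrite ler_wpM2l // bernoulli_half.
apply: ub_le_sup; last by exists r%:C.
exact: (disc_seminormE _ (smooth_disc_pow n)).1.
Qed.

End TestFunctions.

(** * Growth of the seminorms and conclusion *)

Lemma Cinfty_circle_not_locally_bounded (R : realType) :
  ~ locally_bounded (Cinfty_circle R).
Proof.
apply: not_locally_bounded => [l|l C]; first exact: circle_seminorm_is_seminorm.
have [m Cm] : exists m : nat, C <= m%:R.
  exists (Num.bound `|C|); apply: le_trans (ler_norm C) _.
  exact/ltW/archi_boundP.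
(* The degree is at least 1, so its powers are positive and increase with the exponent, and it
   exceeds [C]. *)
exists (smooth_circle_pow R m.+1).
  by rewrite circle_seminorm_pow exprn_gt0.
move=> k kl; rewrite !circle_seminorm_pow.
apply: le_trans (_ : m.+1%:R * m.+1%:R ^+ k <= _).
  by rewrite ler_wpM2r ?exprn_ge0 // (le_trans Cm) // ler_nat.
by rewrite -exprS ler_weXn2l // ler1n.
Qed.

(** Each new factor [n - m] is at least 1 as long as [m < n]; beyond that the falling factorial
    drops to 0. *)
Lemma leq_ffact n k m : (k <= m <= n)%N -> (n ^_ k <= n ^_ m)%N.
Proof.
move=> /andP[]; elim: m => [|m IHm]; first by rewrite leqn0 => /eqP->.
rewrite leq_eqVlt => /predU1P[-> //|km] mn.
rewrite ffactnSr; apply: leq_trans (IHm km (ltnW mn)) _.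
by rewrite leq_pmulr // subn_gt0.
Qed.

Lemma Ainfty_disc_not_locally_bounded (R : realType) :
  ~ locally_bounded (Ainfty_disc R).
Proof.
apply: not_locally_bounded => [l|l C]; first exact: disc_seminorm_is_seminorm.
have [m Cm] : exists m : nat, C <= m%:R.
  exists (Num.bound `|C|); apply: le_trans (ler_norm C) _.
  exact/ltW/archi_boundP.
(* The last factor of [n ^_ l] is then at least [2 * m]: [m] beats [C] and the 2 absorbs the one
   half lost in [disc_seminorm_pow_ge]. Also [l <= n] makes [n ^_ l] positive. *)
pose n := (l + 2 * m)%N; exists (smooth_disc_pow R n).
  apply: lt_le_trans (disc_seminorm_pow_ge _ _ _).
  by rewrite divr_gt0 // ltr0n ffact_gt0 leq_addr.
case: l @n => [//|l] n k kl; apply: le_trans (disc_seminorm_pow_ge _ _ _).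
have p0 : 0 <= disc_seminorm k (smooth_disc_pow R n).
  by apply: le_trans (disc_seminorm_pow_ge _ _ _); rewrite divr_ge0.
apply: le_trans (_ : m%:R * (n ^_ k)%:R <= _).
  apply: le_trans (ler_wpM2r p0 Cm) _.
  by rewrite ler_wpM2l // disc_seminorm_pow_le.
rewrite ler_pdivlMr // -!natrM ler_nat ffactnSr mulnAC mulnC.
apply: leq_mul; first by apply: leq_ffact; rewrite -ltnS kl /n; lia.
by rewrite /n; lia.
Qed.

Theorem theorem12 (R : realType) :
  [/\ ~ normable (Cinfty_circle R),
      ~ normable (Ainfty_disc R),
      ~ isomorphic (Cinfty_circle R) (C_circle R)
    & ~ isomorphic (Ainfty_disc R) (A_disc R)].
Proof.
split.
- by move=> /normable_locally_bounded /Cinfty_circle_not_locally_bounded.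
- by move=> /normable_locally_bounded /Ainfty_disc_not_locally_bounded.
- move=> /(isomorphic_locally_bounded (@circle_norm_is_seminorm R)).
  exact: Cinfty_circle_not_locally_bounded.
- move=> /(isomorphic_locally_bounded (@disc_norm_is_seminorm R)).
  exact: Ainfty_disc_not_locally_bounded.
Qed.
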